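(* For every $k \in \mathbb{N}_0$ and every clause-set $F \in \mathrm{WC}_k$ we have $c(F) \ge \tau(\mathcal{T}_k(F))$.
   Context: Clauses are finite sets of literals without complementary pair, clause-sets finite sets of clauses, $c(F)=|F|$. A partial assignment $\varphi$ applied to $F$ ($\varphi*F$) removes satisfied clauses and falsified literals. Prime implicates $\mathrm{prc}_0(F)$: inclusion-minimal clauses $C$ with $F\models C$. $\overline{C}$ is the set of complements of literals in $C$. W-hardness $\mathrm{whd}(F)$: for unsatisfiable $F$ the minimum $k$ such that there is a resolution tree deriving $\bot$ from $F$ in which every resolution step has a parent clause of length at most $k$ (resolution: $C,D$ with $C\cap\overline{D}=\{x\}$ yield $(C\cup D)\setminus\{x,\overline{x}\}$); $\mathrm{whd}(\top)=0$ for the empty clause-set $\top$; for satisfiable $F\ne\top$ the maximum of $\mathrm{whd}(\varphi*F)$ over partial assignments $\varphi$ with $\varphi*F$ unsatisfiable. $\mathrm{WC}_k := \{F : \mathrm{whd}(F)\le k\}$. Trigger hypergraph $\mathcal{T}_k(F)$: vertex set $\mathrm{prc}_0(F)$, hyperedges $E^k_C := \{C'\in\mathrm{prc}_0(F) : C'\cap\overline{C}=\emptyset \text{ and } |C'\setminus C|\le k\}$ for $C\in\mathrm{prc}_0(F)$. $\tau(G)$ is the transversal number: minimum size of a vertex set meeting every hyperedge. *)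

(* Defs.v *)
From HB Require Import structures.
From mathcomp Require Import all_boot finmap.
From mathcomp Require Import boolp classical_sets.

Set Implicit Arguments.
Unset Strict Implicit.
Unset Printing Implicit Defensive.

Local Open Scope classical_set_scope.
Local Open Scope fset_scope.
Local Open Scope fmap_scope.

(* The default value 0 is never reached by [whd], nor by [tau] on trigger     *)
(* hypergraphs: see [whd_unsat_le], [whd_sat_max] and [tau_trigger_min].      *)
Definition nat_min (P : set nat) : nat :=
  xget 0 [set n | P n /\ forall m, P m -> n <= m].

Definition nat_max (P : set nat) : nat :=
  xget 0 [set n | P n /\ forall m, P m -> m <= n].

Lemma nat_minP (P : set nat) : P !=set0 ->
  P (nat_min P) /\ forall m, P m -> nat_min P <= m.
Proof.
move=> [n0 Pn0].
have ex : exists n, `[< P n >] by exists n0; apply/asboolP.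
apply: (@xgetPex _ 0 [set n | P n /\ forall m, P m -> n <= m]).
case: (ex_minnP ex) => n /asboolP Pn mn.
by exists n; split => // m Pm; apply: mn; apply/asboolP.
Qed.

Lemma nat_maxP (P : set nat) (b : nat) : P !=set0 ->
  (forall m, P m -> m <= b) ->
  P (nat_max P) /\ forall m, P m -> m <= nat_max P.
Proof.
move=> [n0 Pn0] Pb.
have ex : exists n, `[< P n >] by exists n0; apply/asboolP.
have bd n : `[< P n >] -> n <= b by move/asboolP; apply: Pb.
apply: (@xgetPex _ 0 [set n | P n /\ forall m, P m -> m <= n]).
case: (ex_maxnP ex bd) => n /asboolP Pn mn.
by exists n; split => // m Pm; apply: mn; apply/asboolP.
Qed.

(* The literal [(v, true)] is the variable v, [(v, false)] its negation.      *)
Definition lit (V : choiceType) : choiceType := (V * bool)%type.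

Section Defs.
Variable V : choiceType.
Local Notation lit := (lit V).
Implicit Types (l : lit) (A : {fset lit}).

Definition compl l : lit := (l.1, ~~ l.2).

Definition fcompl A : {fset lit} := [fset compl l | l in A].

Definition clash_free A : bool := A `&` fcompl A == fset0.

Record clause := Clause { lits :> {fset lit}; lits_clash_free : clash_free lits }.

HB.instance Definition _ := [isSub for lits].
HB.instance Definition _ := [Choice of clause by <:].

Definition clause_set := {fset clause}.

Implicit Types (C D E : clause) (F : clause_set).

Lemma complK : involutive compl.
Proof. by case=> v b; rewrite /compl /= negbK. Qed.

Lemma in_fcompl A l : (l \in fcompl A) = (compl l \in A).
Proof.
apply/imfsetP/idP => [[m mA ->]|lA]; first by rewrite complK.
by exists (compl l) => //; rewrite complK.
Qed.

Lemma clash_freeP A :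
  reflect (forall l, l \in A -> compl l \notin A) (clash_free A).
Proof.
apply: (iffP eqP) => [A0 l lA|h].
  apply/negP => clA; have: l \in A `&` fcompl A by rewrite inE lA in_fcompl.
  by rewrite A0 inE.
apply/fsetP => l; rewrite !inE in_fcompl; apply/negP => /andP[lA].
by apply/negP/h.
Qed.

Lemma clash_freeS A B : A `<=` B -> clash_free B -> clash_free A.
Proof.
move=> /fsubsetP AB /clash_freeP h; apply/clash_freeP => l lA.
by apply: contra (h l (AB _ lA)); apply: AB.
Qed.

Lemma clash_free0 : clash_free fset0.
Proof. by apply/clash_freeP => l; rewrite inE. Qed.

Definition bot : clause := Clause clash_free0.

Lemma clash_free_filter C (p : pred lit) :
  clash_free [fset l in lits C | p l].
Proof.
apply: clash_freeS (lits_clash_free C).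
by apply/fsubsetP => l; rewrite !inE => /andP[].
Qed.

Definition assignment := {fmap V -> bool}.

Implicit Types phi : assignment.

Definition makes_true phi l : bool := phi.[? l.1] == Some l.2.

Definition makes_false phi l : bool := makes_true phi (compl l).

Definition satisfied phi C : bool := [exists l : lits C, makes_true phi (val l)].

Definition restrict phi C : clause :=
  Clause (clash_free_filter C (fun l => ~~ makes_false phi l)).

Definition papply phi F : clause_set :=
  [fset restrict phi C | C in F & ~~ satisfied phi C].

(* The empty clause-set [fset0] is the clause-set "top". *)
Definition satisfiable F : Prop := exists phi, papply phi F = fset0.

Definition implies F C : Prop :=
  forall phi, papply phi F = fset0 -> papply phi [fset C] = fset0.

Definition prc0 F : set clause :=
  [set C | implies F C /\
           forall D, implies F D -> lits D `<=` lits C -> D = C].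

Definition resolvent C D E : Prop :=
  exists2 x : lit, lits C `&` fcompl D = [fset x] &
    lits E = (lits C `|` lits D) `\` [fset x; compl x].

(* [kres k F C]: some resolution tree derives C from F such that every step   *)
(* has a parent clause of length at most k.                                   *)
Inductive kres (k : nat) (F : clause_set) : clause -> Prop :=
| kres_axiom C : C \in F -> kres k F C
| kres_step C D E : kres k F C -> kres k F D -> resolvent C D E ->
    (#|` lits C| <= k) || (#|` lits D| <= k) -> kres k F E.

Definition whd_unsat F : nat := nat_min [set k | kres k F bot].

Definition whd F : nat :=
  if `[< ~ satisfiable F >] then whd_unsat F
  else if F == fset0 then 0
  else nat_max [set n | exists2 phi, ~ satisfiable (papply phi F) &
                                     n = whd_unsat (papply phi F)].

Definition WC (k : nat) : set clause_set := [set F | whd F <= k].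

Record hypergraph (T : Type) := Hypergraph {
  vertices : set T;
  edges : set (set T) }.

Definition transversal (T : choiceType) (G : hypergraph T) (S : {fset T}) :=
  (forall x, x \in S -> vertices G x) /\
  forall X, edges G X -> exists2 x, x \in S & X x.

Definition tau (T : choiceType) (G : hypergraph T) : nat :=
  nat_min [set n | exists2 S, transversal G S & #|` S| = n].

Definition trigger_edge (k : nat) F C : set clause :=
  [set C' | [/\ prc0 F C', lits C' `&` fcompl C = fset0
             & #|` lits C' `\` lits C| <= k]].

Definition trigger_hypergraph (k : nat) F : hypergraph clause :=
  {| vertices := prc0 F; edges := [set trigger_edge k F C | C in prc0 F]%classic |}.

Lemma clause_inj C D : lits C = lits D -> C = D.
Proof. exact: val_inj. Qed.

Lemma satisfiedP phi C :
  reflect (exists2 l, l \in lits C & makes_true phi l) (satisfied phi C).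
Proof.
apply: (iffP idP) => [/existsP[l h]|[l lC h]]; first by exists (val l) => //; apply: fsvalP.
by apply/existsP; exists [` lC].
Qed.

Lemma papply_top phi F :
  papply phi F = fset0 <-> forall C, C \in F -> satisfied phi C.
Proof.
split=> [h C CF|h].
  case: (boolP (satisfied phi C)) => // nsat.
  have : restrict phi C \in papply phi F.
    by apply/imfsetP; exists C => //; rewrite !inE CF.
  by rewrite h inE.
apply/fsetP => C; rewrite inE; apply/negP => /imfsetP[D]; rewrite !inE.
by move=> /andP[DF /negP nD] _; apply/nD/h.
Qed.

Lemma impliesE F C : implies F C <->
  forall phi, (forall D, D \in F -> satisfied phi D) -> satisfied phi C.
Proof.
split=> h phi.
  move=> /papply_top /h /papply_top; apply; exact: fset11.
by move=> /papply_top Fphi; apply/papply_top => D /fset1P ->; apply: h.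
Qed.

Definition all_lits F : {fset lit} := \bigcup_(C <- F) lits C.

Lemma all_litsP F l :
  reflect (exists2 C, C \in F & l \in lits C) (l \in all_lits F).
Proof.
apply: (iffP (bigfcupP _ _ _ _)) => [[C]|[C CF lC]]; last by exists C; rewrite ?CF.
by rewrite andbT; exists C.
Qed.

Lemma all_lits_papply phi F : all_lits (papply phi F) `<=` all_lits F.
Proof.
apply/fsubsetP => l /all_litsP[D /imfsetP[C]]; rewrite !inE => /andP[CF _] -> /=.
by rewrite !inE => /andP[lC _]; apply/all_litsP; exists C.
Qed.

Lemma refutable_unsat F (k : nat) :
  ~ satisfiable F -> #|` all_lits F| <= k -> kres k F bot.
Proof.
move=> unsat leFk.
pose falsified (f : V -> bool) C := forall l, l \in lits C -> f l.1 = ~~ l.2.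
have main (s : seq V) (f : V -> bool) :
    (forall g, (forall v, v \notin s -> g v = f v) ->
       exists2 C, C \in F & falsified g C) ->
    exists C, [/\ kres k F C, lits C `<=` all_lits F, falsified f C
                & forall l, l \in lits C -> l.1 \notin s].
  elim: s f => [|v s IH] f h.
    have [//|C CF fC] := h f; exists C; split=> //; first exact: kres_axiom.
    by apply/fsubsetP => l lC; apply/all_litsP; exists C.
  pose upd b u := if u == v then b else f u.
  have updE b u : u != v -> upd b u = f u by rewrite /upd => /negPf ->.
  have hb b : exists C, [/\ kres k F C, lits C `<=` all_lits F,
        falsified (upd b) C & forall l, l \in lits C -> l.1 \notin s].
    apply: IH => g hg; apply: h => u; rewrite inE negb_or => /andP[uv us].
    by rewrite hg // updE.
  have done_ b C : kres k F C -> lits C `<=` all_lits F ->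
      falsified (upd b) C -> (forall l, l \in lits C -> l.1 \notin s) ->
      (v, ~~ b) \notin lits C ->
      exists C, [/\ kres k F C, lits C `<=` all_lits F, falsified f C
                & forall l, l \in lits C -> l.1 \notin v :: s].
    move=> kC CF fC sC vC.
    have nv l : l \in lits C -> l.1 != v.
      move=> lC; apply: contraNneq vC => lv.
      have := fC _ lC; rewrite /upd lv eqxx => ->.
      by rewrite negbK -lv -surjective_pairing.
    exists C; split=> // l lC; first by rewrite -(updE b) ?nv // fC.
    by rewrite inE negb_or nv // sC.
  have [C0 [k0 F0 f0 s0]] := hb false; have [C1 [k1 F1 f1 s1]] := hb true.
  case: (boolP ((v, true) \in lits C0)) => [v0|]; last exact: (done_ false).
  case: (boolP ((v, false) \in lits C1)) => [v1|]; last exact: (done_ true).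
  pose A := (lits C0 `|` lits C1) `\` [fset (v, true); (v, false)].
  have AP l : l \in A -> f l.1 = ~~ l.2 /\ l.1 != v.
    case: l => u b; rewrite !inE !xpair_eqE /= => /andP[nuv hl].
    have uv : u != v by move: nuv; case: (u == v) => //; case: (b).
    split=> //; case/orP: hl => hl.
      by rewrite -(updE false) // (f0 _ hl).
    by rewrite -(updE true) // (f1 _ hl).
  have cA : clash_free A.
    apply/clash_freeP => l /AP[fl _]; apply/negP => /AP[]; rewrite /= fl.
    by case: l.2.
  exists (Clause cA); split=> /=.
  - apply: (kres_step k0 k1); last first.
      by apply/orP; left; apply: leq_trans leFk; apply: fsubset_leq_card.
    exists (v, true) => //; apply/fsetP => l; rewrite !inE in_fcompl.
    apply/andP/eqP => [[l0 l1]|->]; last by [].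
    case: (l.1 =P v) => [lv|/eqP lv].
      have := f0 _ l0; rewrite /upd lv eqxx; case: l lv {l0 l1} => u [] //= ->.
      by [].
    have := f0 _ l0; have := f1 _ l1; rewrite /= !updE // => ->.
    by case: l.2.
  - apply/fsubsetP => l; rewrite inE => /andP[_]; rewrite inE => /orP[].
      exact: (fsubsetP F0).
    exact: (fsubsetP F1).
  - by move=> l /AP[].
  - move=> l lA; have [_ lv] := AP _ lA; rewrite inE negb_or lv /=.
    by move: lA; rewrite inE => /andP[_]; rewrite inE => /orP[/s0|/s1].
pose vs : seq V := [seq l.1 | l <- all_lits F].
have [g _|C [kC CF _ sC]] := main vs (fun=> true).
  apply: contrapT => nC; apply: unsat.
  pose phi : assignment := [fmap v : [fset v in vs] => g (val v)].
  exists phi; apply/papply_top => C CF.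
  case: (boolP (satisfied phi C)) => // nsat; case: nC.
  exists C => // l lC.
  have lvs : l.1 \in [fset v in vs].
    by rewrite inE /=; apply: map_f; apply/all_litsP; exists C.
  have : ~~ makes_true phi l.
    by apply: contra nsat => h; apply/satisfiedP; exists l.
  rewrite /makes_true in_fnd ffunE /=.
  by case: (g l.1); case: l.2.
have -> : bot = C; last by [].
apply/clause_inj/fsetP => l; rewrite inE; apply/esym/negP => lC.
by have /negP := sC _ lC; apply; apply: map_f; apply: (fsubsetP CF).
Qed.

Lemma whd_unsat_le F : ~ satisfiable F ->
  kres (whd_unsat F) F bot /\ forall k, kres k F bot -> whd_unsat F <= k.
Proof.
by move=> nF; apply: nat_minP; exists #|` all_lits F|; apply: refutable_unsat.
Qed.

Lemma whd_sat_max F : satisfiable F -> F != fset0 ->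
  (exists2 phi, ~ satisfiable (papply phi F) & whd F = whd_unsat (papply phi F))
  /\ forall phi, ~ satisfiable (papply phi F) ->
       whd_unsat (papply phi F) <= whd F.
Proof.
move=> sF F0; rewrite /whd (negPf F0); case: asboolP => // _.
pose P := [set n | exists2 phi, ~ satisfiable (papply phi F) &
                                n = whd_unsat (papply phi F)]%classic.
have [|m [phi nphi ->]|[phi nphi e] h] := @nat_maxP P #|` all_lits F|.
- have /fset0Pn[C CF] := F0.
  pose phi : assignment :=
    [fmap v : [fset l.1 | l in lits C] => (val v, false) \in lits C].
  have phiC l : l \in lits C -> phi.[? l.1] = Some (~~ l.2).
    move=> lC; have lv : l.1 \in [fset l.1 | l in lits C] by apply: in_imfset.
    rewrite in_fnd ffunE /=; congr Some.
    have /clash_freeP/(_ _ lC) := lits_clash_free C.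
    by case: l lC {lv} => v [] lC; rewrite /compl //= => /negPf.
  exists (whd_unsat (papply phi F)); exists phi => // -[psi /papply_top h].
  have /h/satisfiedP[l] : restrict phi C \in papply phi F; last first.
    by rewrite !inE => /andP[lC]; rewrite /makes_false /makes_true /= phiC ?eqxx.
  apply/imfsetP; exists C => //; rewrite !inE CF /=.
  apply/negP => /satisfiedP[l lC]; rewrite /makes_true phiC //.
  by case: l.2.
- apply: (whd_unsat_le nphi).2; apply: refutable_unsat => //.
  exact/fsubset_leq_card/all_lits_papply.
- by split; [exists phi | move=> psi npsi; apply: h; exists psi].
Qed.

Lemma prc0_all_lits F C : prc0 F C -> lits C `<=` all_lits F.
Proof.
move=> [/impliesE FC minC]; apply/fsubsetP => l lC; apply/negPn/negP => lF.
pose D : clause := Clause (clash_free_filter C (fun m => m != l)).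
have DC : lits D `<=` lits C by apply/fsubsetP => m; rewrite !inE => /andP[].
have FD : implies F D.
  apply/impliesE => phi hphi.
  have /FC/satisfiedP[m mC] :
      forall E, E \in F -> satisfied phi.[l.1 <- ~~ l.2] E.
    move=> E EF; have /satisfiedP[m mE phim] := hphi _ EF.
    apply/satisfiedP; exists m => //.
    rewrite /makes_true fnd_set; case: (m.1 =P l.1) => [ml|//].
    have ml' : m != l.
      by apply: contraNneq lF => <-; apply/all_litsP; exists E.
    case: m l ml ml' {mE phim lC lF D DC} => u b [v c] /= ->.
    by rewrite xpair_eqE eqxx /=; case: b; case: c.
  rewrite /makes_true fnd_set; case: (m.1 =P l.1) => [ml|mnl] phim; last first.
    apply/satisfiedP; exists m => //; rewrite !inE mC /=.
    by apply: contra_notN mnl => /eqP ->.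
  have /clash_freeP/(_ _ lC)/negP[] := lits_clash_free C.
  suff -> : compl l = m by [].
  by case: m ml phim {mC} => u b /= -> /eqP[<-].
have /(congr1 lits)/fsetP/(_ l) := minC _ FD DC.
by rewrite !inE lC eqxx.
Qed.

Lemma has_transversal_trigger (k : nat) F :
  exists S, transversal (trigger_hypergraph k F) S.
Proof.
pose T := [fset odflt bot (insub A) | A in fpowerset (all_lits F)].
exists [fset C in T | `[< prc0 F C >]]; split=> [C|_ [C pC <-]].
  by rewrite !inE => /andP[_ /asboolP].
exists C; last first.
  split=> //; last by rewrite fsetDv.
  exact/eqP/lits_clash_free.
rewrite !inE; apply/andP; split; last exact/asboolP.
apply/imfsetP; exists (lits C); last by rewrite valK.
by rewrite fpowersetE prc0_all_lits.
Qed.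

Lemma tau_trigger_min (k : nat) F :
  (exists2 S, transversal (trigger_hypergraph k F) S
            & #|` S| = tau (trigger_hypergraph k F)) /\
  forall S, transversal (trigger_hypergraph k F) S ->
    tau (trigger_hypergraph k F) <= #|` S|.
Proof.
have [S tS] := has_transversal_trigger k F.
have [|h1 h2] := @nat_minP [set n | exists2 S,
    transversal (trigger_hypergraph k F) S & #|` S| = n]%classic.
  by exists #|` S|; exists S.
by split=> // S' tS'; apply: h2; exists S'.
Qed.

End Defs.

Arguments bot {V}.

(* Main.v *)
(* Choose for every D in F a prime implicate below D; the chosen clauses form
   a transversal of size at most c(F). Indeed, for a prime implicate C the
   assignment phi falsifying exactly the literals of C makes phi * F
   unsatisfiable, and a topmost step of a k-refutation of phi * F has an axiom
   phi * {D} of length at most k as a parent. Then D does not clash with C and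
   has at most k literals outside C, and so does the prime implicate below D. *)

Require Import Defs.
From mathcomp Require Import all_boot finmap.
From mathcomp Require Import boolp classical_sets.

Local Open Scope fset_scope.

Section TriggerTransversal.
Variable V : choiceType.
Implicit Types (C D E P : clause V) (F : clause_set V) (l : lit V) (k : nat).

(** Induction on the tree: if both parents of the last step are axioms, the short one is the
    witness; otherwise a subtree with a step already provides it. The left alternative covers trees
    without steps. *)
Lemma kres_short_axiom k F E : kres k F E ->
  E \in F \/ exists2 D, D \in F & #|` lits D| <= k.
Proof.
elim=> {E} [C CF|C D E _ [CF|?] _ [DF|?] _ short]; try by [left|right].
by right; case/orP: short; [exists C|exists D].
Qed.

Lemma kres_bot_short_axiom k F : kres k F bot ->
  exists2 D, D \in F & #|` lits D| <= k.
Proof.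
(* A tree without steps means that [bot] is itself an axiom, of length 0. *)
by move=> /kres_short_axiom[botF|//]; exists bot; rewrite //= cardfs0.
Qed.

Lemma implies_clause F C : C \in F -> Defs.implies F C.
Proof. by move=> CF; apply/impliesE => phi; apply. Qed.

(** Strong induction on length: an implicate that is not prime properly contains another
    implicate. *)
Lemma prc0_below F C : Defs.implies F C ->
  exists P, prc0 F P /\ lits P `<=` lits C.
Proof.
elim: {C}_.+1 {-2}C (ltnSn #|` lits C|) => // n IHn C ltCn FC.
have [pC|npC] := pselect (prc0 F C); first by exists C.
have [D [FD DC nDC]] : exists D, [/\ Defs.implies F D, lits D `<=` lits C & D <> C].
  apply: contrapT => nD; apply: npC; split=> // D FD DC.
  by apply: contrapT => nDC; apply: nD; exists D.
have ltDC : #|` lits D| < #|` lits C|.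
  apply: fproper_ltn_card; rewrite fproperEneq DC andbT.
  by apply: contra_notN nDC => /eqP; apply: clause_inj.
have [P [pP PD]] := IHn D (leq_trans ltDC ltCn) FD.
by exists P; split=> //; apply: fsubset_trans DC.
Qed.

Definition falsifier C : assignment V :=
  [fmap v : [fset l.1 | l in lits C] => (val v, false) \in lits C].

Lemma makes_true_falsifier C l :
  makes_true (falsifier C) l = (compl l \in lits C).
Proof.
have dom m : m \in lits C -> m.1 \in [fset l.1 | l in lits C].
  by move=> mC; apply: in_imfset.
case: l => v b; rewrite /makes_true /=.
case: (boolP (v \in [fset l.1 | l in lits C])) => [vC|nvC].
  rewrite in_fnd ffunE /= /compl /=; case: b => /=.
    by case: (_ \in _).
  (* For a negative literal clash-freeness enters: exactly one literal over [v] lies in [C], so [v]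
     is set to false iff that one is positive. *)
  have /imfsetP[[u c] uC /= vu] := vC; subst u.
  have /clash_freeP/(_ _ uC) := lits_clash_free C.
  by case: c uC => uC; rewrite /compl /= ?uC => /negPf->.
rewrite not_fnd //; apply/esym/negP => /dom; exact/negP.
Qed.

Lemma makes_false_falsifier C l :
  makes_false (falsifier C) l = (l \in lits C).
Proof. by rewrite /makes_false makes_true_falsifier complK. Qed.

Lemma lits_restrict_falsifier C D :
  lits (restrict (falsifier C) D) = lits D `\` lits C.
Proof.
by apply/fsetP => l; rewrite !inE /= makes_false_falsifier andbC.
Qed.

Lemma not_satisfied_falsifier C D :
  ~~ satisfied (falsifier C) D -> lits D `&` fcompl (lits C) = fset0.
Proof.
move=> nsat; apply/fsetP => l; rewrite !inE in_fcompl.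
apply/negP => /andP[lD lC]; apply/negP: nsat; rewrite negbK.
by apply/satisfiedP; exists l; rewrite ?makes_true_falsifier.
Qed.

Lemma makes_true_catf (phi psi : assignment V) l :
  makes_true (psi + phi)%fmap l =
  makes_true phi l || makes_true psi l && ~~ makes_false phi l.
Proof.
rewrite /makes_false /makes_true fnd_cat /=.
have [vphi|nvphi] := boolP (l.1 \in domf phi); last first.
  by rewrite (not_fnd nvphi) andbT.
rewrite (in_fnd vphi).
by case: (phi _); case: l.2; rewrite /= ?andbF.
Qed.

(** In [psi + phi] the right operand takes precedence, so this is the composition that applies [phi]
    first and [psi] to what remains. *)
Lemma satisfied_catf (phi psi : assignment V) D :
  satisfied (psi + phi)%fmap D =
  satisfied phi D || satisfied psi (restrict phi D).
Proof.
apply/satisfiedP/orP => [[l lD]|[/satisfiedP[l lD tl]|/satisfiedP[l]]].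
- rewrite makes_true_catf => /orP[tl|/andP[tl nfl]]; [left|right];
    by apply/satisfiedP; exists l; rewrite // !inE lD.
- by exists l; rewrite // makes_true_catf tl.
- by rewrite !inE => /andP[lD nfl] tl; exists l; rewrite // makes_true_catf tl nfl orbT.
Qed.

(** A [psi] satisfying the restricted clause-set would make [psi + falsifier C] a model of [F] that
    falsifies the implicate [C]. *)
Lemma papply_falsifier_unsat F C :
  Defs.implies F C -> ~ satisfiable (papply (falsifier C) F).
Proof.
move=> /impliesE FC [psi /papply_top h].
have : satisfied (psi + falsifier C)%fmap C.
  apply: FC => D DF; rewrite satisfied_catf.
  case: (boolP (satisfied _ D)) => //= nsat; apply: h.
  by apply/imfsetP; exists D; rewrite // !inE DF.
case/satisfiedP => l lC.
rewrite makes_true_catf makes_false_falsifier lC andbF orbF makes_true_falsifier.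
by apply/negP; move/clash_freeP: (lits_clash_free C); apply.
Qed.

Lemma WC_near_clause k F C : WC k F -> prc0 F C ->
  exists2 D, D \in F &
    lits D `&` fcompl (lits C) = fset0 /\ #|` lits D `\` lits C| <= k.
Proof.
rewrite /WC /= => whdF [FC minC].
have [satF|unsatF] := pselect (satisfiable F); last first.
  (* An unsatisfiable [F] implies every clause, so its only prime implicate is [bot], and a
     refutation of [F] itself gives the short clause. *)
  have botC : bot = C.
    apply: minC; last exact: fsub0set.
    by move=> phi phiF; case: unsatF; exists phi.
  move: whdF; rewrite /whd; case: asboolP => // _ whdF.
  have [D DF szD] := kres_bot_short_axiom _ _ (whd_unsat_le unsatF).1.
  exists D; rewrite // -botC /= fsetD0; split; last exact: leq_trans szD whdF.
  by apply/fsetP => l; rewrite !inE in_fcompl inE andbF.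
have unsatphi := papply_falsifier_unsat _ _ FC.
have F0 : F != fset0.
  apply: contra_notN unsatphi => /eqP ->.
  by exists fmap0; apply/papply_top => D /imfsetP[E]; rewrite !inE.
have [_ /(_ _ unsatphi) whdphi] := whd_sat_max satF F0.
have [_ /imfsetP[D + ->] szD] :=
  kres_bot_short_axiom _ _ (whd_unsat_le unsatphi).1.
rewrite !inE => /andP[DF nsat]; exists D => //; split.
  exact: not_satisfied_falsifier.
by rewrite -lits_restrict_falsifier (leq_trans szD) // (leq_trans whdphi).
Qed.

End TriggerTransversal.

Theorem theorem6p4 (V : choiceType) (k : nat) (F : clause_set V) :
  WC k F -> tau (trigger_hypergraph k F) <= #|` F|.
Proof.
move=> FWC.
have /choice[f fP] : forall D, exists P,
    D \in F -> prc0 F P /\ lits P `<=` lits D.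
  move=> D; have [/implies_clause/prc0_below[P]|_] := boolP (D \in F).
    by exists P.
  (* Choice needs a total function; outside [F] the default is [D] itself. *)
  by exists D.
apply: (@leq_trans #|` f @` F|); last exact: leq_imfset_card.
apply: (tau_trigger_min k F).2; split=> [_ /imfsetP[D DF ->]|_ [C pC <-]].
  exact: (fP D DF).1.
have [D DF [DC szD]] := WC_near_clause _ _ _ _ FWC pC.
have [pfD fDD] := fP D DF.
exists (f D); first exact: in_imfset.
(* Both edge conditions pass from [D] to the subset [f D]. *)
split=> //; first by apply/eqP; rewrite -fsubset0 -DC fsetSI.
by apply: leq_trans szD; apply/fsubset_leq_card/fsetSD.
Qed.
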